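(* Let $n\ge 1$ and $m\ge 1$ be integers. The graph of pattern overlaps $\vec{P}_n$ over the alphabet $[m]$ contains a Hamiltonian circuit, i.e. a directed closed walk that visits every vertex of $\vec{P}_n$ exactly once.
   Context: Let $[m]=\{1,\ldots,m\}$ with its natural order. A pattern is a nonempty word which, for some $k\ge1$, contains each of the letters $1,\ldots,k$ at least once and no other letters. The graph of pattern overlaps $\vec{P}_n$ over $[m]$ is the directed graph whose vertices are all patterns of length $n$ over $[m]$, with an arc from $u$ to $v$ if and only if $u=aw$ and $v=wb$ for some word $w$ of length $n-1$ and letters $a,b\in[m]$ (loops allowed; this is the subgraph of the de Bruijn graph on $[m]^n$ induced by the patterns). *)

(* Defs.v *)
From mathcomp Require Import all_boot.

Set Implicit Arguments.
Unset Strict Implicit.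
Unset Printing Implicit Defensive.

(* The ordinal a : 'I_m encodes the letter a.+1 of [m] = {1, ..., m}. *)
Definition letter (m : nat) (a : 'I_m) : nat := a.+1.

(* A word over [m] cannot contain a letter beyond m, so bounding k by m
   loses nothing; see patternP. *)
Definition pattern (m : nat) (w : seq 'I_m) : bool :=
  (w != [::]) &&
  [exists k : 'I_m.+1, (1 <= k) && [forall a, (a \in w) == (letter a <= k)]].

Lemma patternP (m : nat) (w : seq 'I_m) :
  reflect (w <> [::] /\ exists2 k, 1 <= k &
             forall j : nat, (j \in map (@letter m) w) = (1 <= j <= k))
          (pattern w).
Proof.
have injl : injective (@letter m) by move=> a b [] /val_inj.
apply: (iffP andP) => [[/eqP w0 /existsP[k /andP[k1 /forallP H]]] |
                       [w0 [k k1 H]]].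
  split=> //; exists (val k) => // -[|j]; first by apply/mapP => -[].
  have [jm|mj] := ltnP j m.
    by rewrite -[j.+1]/(letter (Ordinal jm)) mem_map // (eqP (H _)).
  rewrite [RHS]leqNgt (leq_trans (ltn_ord k)) //.
  by apply/mapP => -[a _ [ja]]; move: mj; rewrite ja leqNgt ltn_ord.
split; first exact/eqP.
have km : k < m.+1.
  have /mapP[a _ ->] : k \in map (@letter m) w by rewrite H k1 leqnn.
  exact: ltn_ord.
apply/existsP; exists (Ordinal km); rewrite /= k1; apply/forallP => a.
by rewrite -(mem_map injl) H.
Qed.

Definition overlap (m n : nat) : rel (n.-tuple 'I_m) :=
  fun u v => [exists w : n.-1.-tuple 'I_m, exists a : 'I_m, exists b : 'I_m,
    (tval u == a :: w) && (tval v == rcons w b)].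

Definition pattern_of (m n : nat) := {w : n.-tuple 'I_m | pattern w}.

Definition pattern_overlap (m n : nat) : rel (pattern_of m n) :=
  fun u v => overlap (val u) (val v).

(* [cycle e c] includes the arc from the last vertex of c back to the first;
   for c = [:: x] it demands the loop e x x. *)
Definition hamiltonian_circuit (T : finType) (e : rel T) (c : seq T) : Prop :=
  [/\ c != [::], cycle e c, uniq c & forall x : T, x \in c].

(* Main.v *)
(** The arcs [aw -> wb] form a line digraph, and rotation [aw -> wa] is a
    permutation of the patterns along arcs.  If [aw] and [bw] lie on different
    cycles of such a permutation, exchanging their successors keeps it along
    arcs and merges the two cycles; hence in a permutation with the fewest
    cycles every cycle is closed under arcs.  Finally, every pattern reaches
    [1...1]: rotate an occurrence of its largest letter to the front and
    replace it by [1], and repeat. *)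

Require Import Defs.
From mathcomp Require Import all_boot fingroup perm.

Set Implicit Arguments.
Unset Strict Implicit.
Unset Printing Implicit Defensive.

Lemma hamiltonian_circuit_porbit (T : finType) (e : rel T) (s : {perm T}) z :
  (forall x, e x (s x)) -> (forall x, x \in porbit s z) ->
  hamiltonian_circuit e (orbit s z).
Proof.
move=> es sz; split.
- by rewrite -size_eq0 size_orbit -lt0n fingraph.order_gt0.
- apply: sub_cycle (cycle_orbit (@perm_inj _ s) z).
  by move=> x y /eqP <-.
- exact: orbit_uniq.
- move=> x; rewrite -fconnect_orbit; have /porbitP[i ->] := sz x.
  by rewrite permX fconnect_iter.
Qed.

(* The exchange hypothesis characterises line digraphs. *)
Lemma line_digraph_hamiltonian (T : finType) (e : rel T) (s0 : {perm T}) z :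
  (forall x x' y y', e x y -> e x' y -> e x' y' -> e x y') ->
  (forall x, e x (s0 x)) -> (forall x, connect e x z) ->
  exists c, hamiltonian_circuit e c.
Proof.
move=> exch es0 cz.
pose along (s : {perm T}) := [forall x, e x (s x)].
have along0 : along s0 by apply/forallP.
case: (arg_minnP (fun s => #|porbits s|) along0) => s /forallP es s_min.
have same_orbit x x' y : e x y -> e x' y -> x \in porbit s x'.
  move=> exy ex'y; apply/contraT => xNx'.
  (* Precomposing [s] with [tperm x x'] exchanges the successors of [x] and [x'], which merges their
     cycles when these differ. *)
  have := porbits_mul_tperm s x x'; rewrite /= xNx' => E.
  have : along (tperm x x' * s)%g.
    apply/forallP => u; rewrite permM; case: tpermP => [->|->|_ _] //.
      exact: exch exy ex'y (es _).
    exact: exch ex'y exy (es _).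
  (* Combined with [E], minimality of [s] would give [2 <= (x != x')], impossible for a boolean. *)
  move/s_min; rewrite -(leq_add2r 2) E leq_add2l.
  by case: (x != x').
have arc_orbit x y : e x y -> porbit s x = porbit s y.
  (* The [s]-predecessor of [y] is an in-neighbour of [y] too, so [x] lies on its cycle, which is
     the cycle of [y]. *)
  move=> exy; have esy : e (s^-1 y)%g y by rewrite -{2}(permKV s y).
  rewrite -(permKV s y) -[s _]/((s ^+ 1)%g _) porbit_perm.
  by apply/eqP; rewrite eq_porbit_mem (same_orbit _ _ _ exy esy).
exists (orbit s z); apply: hamiltonian_circuit_porbit => // x.
have /connectP[p] := cz x; rewrite -eq_porbit_mem.
elim: p x => [|y p IHp] x /= => [_ -> // | /andP[/arc_orbit -> ep] ez].
exact: IHp.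
Qed.

(** Eliminates the bound [k]: initial segments are the downward closed sets, and [k] is recovered
    from the largest letter. *)
Lemma pattern_downP (m : nat) (w : seq 'I_m) :
  reflect (w <> [::] /\ forall a b : 'I_m, a <= b -> b \in w -> a \in w)
          (pattern w).
Proof.
apply: (iffP andP) => [[/eqP w0 /existsP[k /andP[_ /forallP wk]]] | [w0 down]].
  split=> // a b le_ab; rewrite !(eqP (wk _)); exact: leq_ltn_trans.
split; first exact/eqP.
case: w w0 down => // x w _ down.
have x_in : x \in x :: w by rewrite mem_head.
case: (arg_maxnP (fun a : 'I_m => a : nat) x_in) => k k_in k_max.
(* The ordinal [k] encodes the letter [k.+1], which is the value of [lift ord0 k]. *)
apply/existsP; exists (lift ord0 k); rewrite lift0 /=.
apply/forallP => a; apply/eqP; apply/idP/idP => [/k_max // | le_ak].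
exact: down k_in.
Qed.

Lemma eq_mem_pattern (m : nat) (w1 w2 : seq 'I_m) :
  w1 =i w2 -> pattern w1 -> pattern w2.
Proof.
move=> eqw /pattern_downP[w10 down]; apply/pattern_downP; split.
  by case: w2 eqw => // eqw _; case: w1 w10 eqw {down} => // a w1 _ /(_ a);
    rewrite mem_head.
by move=> a b; rewrite -!eqw; exact: down.
Qed.

(** Only the letter [k] can disappear, and then no larger letter remains that would leave a gap. *)
Lemma pattern_replace_max (m : nat) (k : 'I_m.+1) (w : seq 'I_m.+1) :
  (forall b, b \in w -> b <= k) -> pattern (k :: w) -> pattern (rcons w ord0).
Proof.
move=> k_max /pattern_downP[_ down]; apply/pattern_downP.
split=> [|a b le_ab]; first by case: w {k_max down}.
rewrite !mem_rcons !inE => /orP[/eqP b0|bw]; apply/orP.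
  by left; rewrite -val_eqE /= -leqn0; rewrite b0 in le_ab.
have : (a == k) || (a \in w).
  by rewrite -in_cons (down a b) // in_cons bw orbT.
case/orP=> [/eqP ak|aw]; right=> //; suff -> : a = b by [].
by apply/val_inj/anti_leq; rewrite /= le_ab ak k_max.
Qed.

(** An arc becomes an equation between a function of its source and a function of its target, which
    makes the exchange property immediate. *)
Lemma overlapE (m n : nat) (u v : n.+1.-tuple 'I_m) :
  overlap u v = (behead u == take n v).
Proof.
apply/existsP/eqP => [[w /existsP[a /existsP[b /andP[/eqP-> /eqP->]]]] | uv].
  by rewrite -cats1 take_size_cat ?size_tuple.
exists [tuple of behead u]; apply/existsP; exists (thead u).
(* The default [thead u] is never returned, as [v] is nonempty. *)
apply/existsP; exists (last (thead u) v); rewrite {1}(tuple_eta u) eqxx /= uv.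
case/lastP: (tval v) (size_tuple v) => // s b; rewrite size_rcons => -[sz].
by rewrite last_rcons -[in take _ _]cats1 take_size_cat.
Qed.

Section PatternGraph.

Variables m n : nat.
Implicit Types u v : pattern_of m.+1 n.+1.
Local Notation arc := (@pattern_overlap m.+1 n.+1).

Lemma pattern_rot1 u : pattern [tuple of rot 1 (val u)].
Proof. by apply: eq_mem_pattern (valP u) => a; rewrite mem_rot. Qed.

Definition pattern_rotate u : pattern_of m.+1 n.+1 :=
  exist (fun w : n.+1.-tuple _ => pattern w) _ (pattern_rot1 u).

Lemma pattern_rotate_inj : injective pattern_rotate.
Proof.
by move=> u v /(congr1 val)/(congr1 val) /= /rot_inj /val_inj /val_inj.
Qed.

Lemma arc_rotate u : arc u (pattern_rotate u).
Proof.
rewrite /pattern_overlap overlapE /=.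
case/tupleP: (val u) => a w /=.
by rewrite rot1_cons -cats1 take_size_cat ?size_tuple.
Qed.

Lemma arc_exchange u u' v v' : arc u v -> arc u' v -> arc u' v' -> arc u v'.
Proof. by rewrite /pattern_overlap !overlapE => /eqP-> /eqP<-. Qed.

(** The bound matters: past the length of the word [rot i] is the identity, while the iterated
    rotation keeps turning. *)
Lemma val_iter_rotate i u :
  i <= n.+1 -> val (val (iter i pattern_rotate u)) = rot i (val u).
Proof.
elim: i => [|i IHi] lt_in; first by rewrite rot0.
by rewrite iterS /= IHi ?(ltnW lt_in) // -rotS // size_tuple.
Qed.

Lemma pattern_ones : pattern [tuple of nseq n.+1 (@ord0 m)].
Proof.
apply/pattern_downP; split=> // a b le_ab; rewrite !mem_nseq /= => /eqP b0.
by rewrite -val_eqE /= -leqn0; rewrite b0 in le_ab.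
Qed.

Definition ones : pattern_of m.+1 n.+1 :=
  exist (fun w : n.+1.-tuple _ => pattern w) _ pattern_ones.

Lemma connect_ones u : connect arc u ones.
Proof.
(* Induction on the number of letters other than 1, encoded by [ord0]. *)
have [d] := ubnP (count (predC1 ord0) (val u)).
elim: d u => // d IHd u lt_d.
have u_in : thead (val u) \in val u by rewrite mem_tnth.
case: (arg_maxnP (fun a : 'I_m.+1 => a : nat) u_in) => k k_in k_max.
have [k0 | k_neq0] := eqVneq k ord0.
  suff -> : u = ones by [].
  have /all_pred1P : all (pred1 ord0) (val u).
    by apply/allP => a /k_max; rewrite k0 /= -val_eqE /= -leqn0.
  by rewrite size_tuple => uE; apply/val_inj/val_inj.
(* Rotating by the position of the first [k] brings it to the front, where the next arc drops it. *)
pose i := index k (val u).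
have lt_i : i < n.+1 by rewrite -[n.+1](size_tuple (val u)) index_mem.
pose u' := iter i pattern_rotate u.
have uu' : connect arc u u'.
  rewrite /u'; elim: (i) => //= j IHj.
  exact: connect_trans IHj (connect1 (arc_rotate _)).
have u'P : perm_eq (val u') (val u) by rewrite val_iter_rotate 1?ltnW ?perm_rot.
have u'E : tval (val u') = k :: behead (val u').
  by rewrite val_iter_rotate 1?ltnW // rot_index.
have vP : pattern [tuple of rcons (behead (val u')) ord0].
  apply: (@pattern_replace_max _ k); last by rewrite -u'E; exact: (valP u').
  by move=> b /mem_behead; rewrite (perm_mem u'P); exact: k_max.
pose v : pattern_of m.+1 n.+1 :=
  exist (fun w : n.+1.-tuple _ => pattern w) _ vP.
apply: connect_trans uu' (connect_trans (connect1 (_ : arc _ v)) (IHd v _)).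
  rewrite /pattern_overlap overlapE /= -cats1 take_size_cat //.
  by rewrite size_behead size_tuple.
(* Rotation preserves the count; trading [k], which is not [ord0], for [ord0] lowers it by one. *)
move: lt_d; rewrite -(seq.permP u'P) u'E /= k_neq0 add1n ltnS.
by rewrite -cats1 count_cat /= addn0 addn0.
Qed.

End PatternGraph.

Theorem theorem6 (n m : nat) (hn : 1 <= n) (hm : 1 <= m) :
  exists c : seq (pattern_of m n), hamiltonian_circuit (@pattern_overlap m n) c.
Proof.
case: n m hn hm => // n [//|m] _ _.
apply: (@line_digraph_hamiltonian _ _
  (perm (@pattern_rotate_inj m n)) (ones m n)).
- exact: arc_exchange.
- by move=> u; rewrite permE arc_rotate.
- exact: connect_ones.
Qed.
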